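(* Let $\mu$ be a continuous, compactly supported Borel probability measure on $\mathbb{R}$ with $0\notin\operatorname{supp}(\mu)$, and let $$\rho=\tfrac12\left(\mu\times\delta_0+\delta_0\times\mu\right)$$ be the corresponding (non-overlapping symmetric) additive measure on $\mathbb{R}^2$. Suppose that $\Lambda_\mu\subset\mathbb{R}$ is a countable set such that $E(\Lambda_\mu)$ is a Riesz basis for $L^2(\mu)$. Then $L^2(\rho)$ also admits a Riesz basis $E(\Lambda_\rho)$ of the form $$\Lambda_\rho=\{(\lambda,\lambda):\lambda\in\Lambda_\mu\}+\{(0,0),(0,\tau)\}$$ for some $\tau\in\mathbb{R}\setminus\{0\}$. In particular, if $\mu$ is Riesz-spectral, then so is $\rho$.
   Context: A Borel measure $\mu$ on $\mathbb{R}$ is continuous if $\mu(\{x\})=0$ for all $x\in\mathbb{R}$. $\delta_0$ is the Dirac measure at $0$. Thus $\int F\,d\rho=\frac12\int F(x,0)\,d\mu(x)+\frac12\int F(0,y)\,d\mu(y)$. For a point $\lambda\in\mathbb{R}^d$ ($d=1,2$), $e_\lambda(x)=e^{2\pi i\lambda\cdot x}$, and for a countable set $\Lambda\subset\mathbb{R}^d$, $E(\Lambda)=\{e_\lambda:\lambda\in\Lambda\}$. For a Borel probability measure $\sigma$ on $\mathbb{R}^d$, $E(\Lambda)$ is a frame for $L^2(\sigma)$ if there are constants $A,B>0$ with $A\|f\|^2\le\sum_{\lambda\in\Lambda}|\langle f,e_\lambda\rangle|^2\le B\|f\|^2$ for all $f\in L^2(\sigma)$. $E(\Lambda)$ is a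 Riesz basis for $L^2(\sigma)$ if it is a frame and there are constants $A,B>0$ such that $A\sum|c_\lambda|^2\le\|\sum c_\lambda e_\lambda\|^2\le B\sum|c_\lambda|^2$ for every family $(c_\lambda)_{\lambda\in\Lambda}$ of complex numbers with only finitely many nonzero terms. The measure $\sigma$ is Riesz-spectral if $L^2(\sigma)$ has a Riesz basis of the form $E(\Lambda)$. The sum of two sets is the Minkowski sum. *)

(* Defs.v *)
From HB Require Import structures.
From mathcomp Require Import all_boot all_order all_algebra.
From mathcomp Require Import all_classical all_reals all_analysis.
From mathcomp Require Import complex.

Set Implicit Arguments.
Unset Strict Implicit.
Unset Printing Implicit Defensive.

Import Order.TTheory GRing.Theory Num.Theory.
Import numFieldNormedType.Exports.

Local Open Scope classical_set_scope.
Local Open Scope ring_scope.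
Local Open Scope complex_scope.

Definition sqmod (R : realType) (z : R[i]) : R :=
  ComplexField.Normc.normc z ^+ 2.

Section L2.
Context d (T : measurableType d) (R : realType).
Variable sigma : {measure set T -> \bar R}.

Definition cintegral (f : T -> R[i]) : R[i] :=
  (\int[sigma]_x complex.Re (f x)) +i* (\int[sigma]_x complex.Im (f x)).

Definition L2normsq (f : T -> R[i]) : \bar R :=
  (\int[sigma]_x (sqmod (f x))%:E)%E.

(* Functions, not classes modulo almost-everywhere equality: all the notions
   below are invariant under modification on a null set. *)
Definition L2 : set (T -> R[i]) :=
  [set f | [/\ measurable_fun setT (fun x => complex.Re (f x)),
               measurable_fun setT (fun x => complex.Im (f x)) &
               (L2normsq f < +oo)%E]].

(* Linear in the first argument. *)
Definition L2inner (f g : T -> R[i]) : R[i] :=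
  cintegral (fun x => f x * conjc (g x)).

End L2.

Section riesz_basis.
Context d (T : measurableType d) (R : realType) (I : choiceType).
Variables (e : I -> T -> R[i]) (sigma : probability T R).

Definition is_frame (L : set I) : Prop :=
  exists A B : R, [/\ 0 < A, 0 < B &
    forall f, L2 sigma f ->
      (A%:E * L2normsq sigma f
         <= \esum_(l in L) (sqmod (L2inner sigma f (e l)))%:E
         <= B%:E * L2normsq sigma f)%E].

(* \sum_(l \in L) sums over the l in L with a nonzero term, and is 0 when there
   are infinitely many; hence the finiteness condition on c. *)
Definition riesz_bounds (L : set I) : Prop :=
  exists A B : R, [/\ 0 < A, 0 < B &
    forall c : I -> R[i], finite_set (L `&` [set l | c l != 0]) ->
      ((A * \sum_(l \in L) sqmod (c l))%:E
         <= L2normsq sigma (fun x => (\sum_(l \in L) c l * e l x)%R)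
         <= (B * \sum_(l \in L) sqmod (c l))%:E)%E].

Definition is_riesz_basis (L : set I) : Prop := is_frame L /\ riesz_bounds L.

Definition riesz_spectral : Prop :=
  exists L : set I, countable L /\ is_riesz_basis L.

End riesz_basis.

Definition expi (R : realType) (t : R) : R[i] := cos t +i* sin t.

Definition exp1 (R : realType) (l x : R) : R[i] :=
  expi (2 * pi * (l * x)).

Definition exp2 (R : realType) (l x : R * R) : R[i] :=
  expi (2 * pi * (l.1 * x.1 + l.2 * x.2)).

Definition continuous_measure (R : realType)
    (mu : {measure set R -> \bar R}) : Prop :=
  forall x : R, mu [set x] = 0%E.

Definition msupport (R : realType) (mu : {measure set R -> \bar R}) : set R :=
  [set x | forall U : set R, open U -> U x -> (0 < mu U)%E].

Section additive_measure.
Context (R : realType) (mu : probability R R).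
Local Open Scope ereal_scope.

(* The product sigma-algebra on R * R is the Borel sigma-algebra of the plane. *)
Definition additive_measure : set (R * R) -> \bar R :=
  mscale ((2^-1 : R)%:nng)%R
    (measure_add (mu \x \d_(0%R : R)) (\d_(0%R : R) \x mu)).

HB.instance Definition _ := Measure.on additive_measure.

Let additive_measure_setT : additive_measure setT = 1.
Proof.
have mu_delta : (mu \x \d_(0%R : R)) setT = 1.
  by rewrite -setXTT product_measure1E//= !probability_setT mule1.
have delta_mu : (\d_(0%R : R) \x mu) setT = 1.
  by rewrite -setXTT product_measure1E//= !probability_setT mule1.
transitivity ((2^-1 : R)%:E * ((mu \x \d_(0%R : R)) setT +
                               (\d_(0%R : R) \x mu) setT)).
  by congr (_ * _); exact: measure_addE.
rewrite mu_delta delta_mu -EFinD -EFinM.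
by congr EFin; rewrite mulVf// pnatr_eq0.
Qed.

HB.instance Definition _ :=
  Measure_isProbability.Build _ _ _ additive_measure additive_measure_setT.

End additive_measure.

(* Main.v *)
Require Import Defs.
From HB Require Import structures.
From mathcomp Require Import all_boot all_order all_algebra.
From mathcomp Require Import all_classical all_reals all_analysis.
From mathcomp Require Import complex.
From mathcomp Require Import measurable_realfun ring lra.

Set Implicit Arguments.
Unset Strict Implicit.
Unset Printing Implicit Defensive.

Import Order.TTheory GRing.Theory Num.Theory.
Import numFieldNormedType.Exports.

Local Open Scope classical_set_scope.
Local Open Scope ring_scope.

(** The measure rho lives on the two coordinate axes, so a function F in L2(rho)
    is the same thing as the pair (f, g) of functions f(x) = F(x, 0) and
    g(x) = F(0, x) in L2(mu), with squared norm (|f|^2 + |g|^2) / 2.  On the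
    axes, the exponential of frequency (l, l) becomes the pair (e_l, e_l), and
    the one of frequency (l, l + tau) becomes (e_l, m e_l) with m = e_tau.
    Hence synthesis with the new system is synthesis with the old one in each
    of two components, followed by the multiplication operator
      (u, v) |-> (u + v, u + m v),
    a 2 x 2 Vandermonde matrix with determinant m - 1, and analysis is the
    adjoint picture with the conjugate of m.  Everything reduces to choosing
    tau so that this matrix is boundedly invertible, that is, so that
    |e_tau - 1| stays away from 0 on the support of mu.  Since the support lies
    in some annulus e <= |x| <= M, the frequency tau = 1 / (2 M) works: the
    phase 2 pi tau x then has absolute value between pi e / M and pi
    ([separating_frequency]).

    Invertibility is used in the form of a pointwise comparison of squared
    moduli ([sqmod_vandermonde_le], [sqmod_le_vandermonde]), integrated in
    [L2normsq_vandermonde].  The frame inequalities follow because the inner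
    product of F with the exponential of frequency (l, l + t) is the inner
    product in L2(mu) of a single folded function with e_l ([L2inner_diag]);
    the Riesz inequalities follow by splitting the coefficients into those on
    the diagonal and those on the shifted diagonal. *)

(** * Complex-valued measurable functions and the Vandermonde comparison *)
Section complex_valued.
Local Open Scope complex_scope.
Variable R : realType.
Implicit Types z u v m : R[i].

Lemma sqmodE z : sqmod z = complex.Re z ^+ 2 + complex.Im z ^+ 2.
Proof.
case: z => a b; rewrite /sqmod /ComplexField.Normc.normc /=.
by rewrite sqr_sqrtr// addr_ge0// sqr_ge0.
Qed.

Lemma sqmod_ge0 z : 0 <= sqmod z.
Proof. exact: sqr_ge0. Qed.

Lemma sqmodM u v : sqmod (u * v) = sqmod u * sqmod v.
Proof. by rewrite /sqmod ComplexField.Normc.normcM exprMn. Qed.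

Lemma sqmodN z : sqmod (- z) = sqmod z.
Proof. by rewrite !sqmodE; case: z => a b /=; rewrite !sqrrN. Qed.

Lemma sqmodJ z : sqmod (conjc z) = sqmod z.
Proof. by rewrite !sqmodE; case: z => a b /=; rewrite sqrrN. Qed.

Lemma sqmodD_le u v : sqmod (u + v) <= 2 * (sqmod u + sqmod v).
Proof.
rewrite !sqmodE; case: u => a b; case: v => c d /=.
by have := sqr_ge0 (a - c); have := sqr_ge0 (b - d); nra.
Qed.

Lemma sqmodB_le u v : sqmod (u - v) <= 2 * (sqmod u + sqmod v).
Proof. by rewrite -(sqmodN v) sqmodD_le. Qed.

Lemma sqmod_vandermonde_le m u v : sqmod m = 1 ->
  sqmod (u + v) + sqmod (u + m * v) <= 4 * (sqmod u + sqmod v).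
Proof.
move=> m1; have := sqmodD_le u v; have := sqmodD_le u (m * v).
rewrite sqmodM m1; lra.
Qed.

(** The inverse of the matrix is explicit: (m - 1) v is the difference of the
    two combinations, and u is the first one minus v.  With P the sum of their
    squared moduli this gives |v|^2 <= 2 P / c and |u|^2 <= 2 P + 2 |v|^2, whence
    the constant 2 + 6 / c. *)
Lemma sqmod_le_vandermonde m u v (c : R) :
  sqmod m = 1 -> 0 < c -> c <= sqmod (m - 1) ->
  sqmod u + sqmod v <= (2 + 6 / c) * (sqmod (u + v) + sqmod (u + m * v)).
Proof.
move=> m1 c0 cm; set P := sqmod (u + v) + sqmod (u + m * v).
have sv : c * sqmod v <= 2 * P.
  have -> : P = sqmod (u + m * v) + sqmod (u + v) by rewrite addrC.
  apply: le_trans (sqmodB_le _ _).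
  have -> : u + m * v - (u + v) = (m - 1) * v by ring.
  by rewrite sqmodM ler_wpM2r// sqmod_ge0.
have su : sqmod u <= 2 * P + 2 * sqmod v.
  have := sqmodB_le (u + v) v; rewrite addrK /P.
  have := sqmod_ge0 (u + m * v); lra.
have {}sv : sqmod v <= 2 * P / c by rewrite ler_pdivlMr// mulrC.
have -> : (2 + 6 / c) * P = 2 * P + 3 * (2 * P / c) by ring.
lra.
Qed.

(** The measurability half of membership in [L2]. *)
Definition cmeasurable d (T : measurableType d) (f : T -> R[i]) : Prop :=
  measurable_fun setT (fun x => complex.Re (f x)) /\
  measurable_fun setT (fun x => complex.Im (f x)).

Section cmeasurable_theory.
Context d (T : measurableType d).
Implicit Types f g : T -> R[i].

Lemma cmeasurable_cst z : cmeasurable (fun _ : T => z).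
Proof. by split; exact: measurable_cst. Qed.

Lemma cmeasurableD f g : cmeasurable f -> cmeasurable g ->
  cmeasurable (fun x => f x + g x).
Proof.
move=> [f1 f2] [g1 g2]; split.
- rewrite [X in measurable_fun _ X](_ : _ =
    (fun x => complex.Re (f x) + complex.Re (g x))); first exact: measurable_funD.
  by apply/funext => x; case: (f x) (g x) => a b [].
- rewrite [X in measurable_fun _ X](_ : _ =
    (fun x => complex.Im (f x) + complex.Im (g x))); first exact: measurable_funD.
  by apply/funext => x; case: (f x) (g x) => a b [].
Qed.

Lemma cmeasurableM f g : cmeasurable f -> cmeasurable g ->
  cmeasurable (fun x => f x * g x).
Proof.
move=> [f1 f2] [g1 g2]; split.
- rewrite [X in measurable_fun _ X](_ : _ =
    (fun x => complex.Re (f x) * complex.Re (g x)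
              - complex.Im (f x) * complex.Im (g x))).
    by apply: measurable_funB; exact: measurable_funM.
  by apply/funext => x; case: (f x) (g x) => a b [].
- rewrite [X in measurable_fun _ X](_ : _ =
    (fun x => complex.Re (f x) * complex.Im (g x)
              + complex.Im (f x) * complex.Re (g x))).
    by apply: measurable_funD; exact: measurable_funM.
  by apply/funext => x; case: (f x) (g x) => a b [].
Qed.

Lemma cmeasurableJ f : cmeasurable f -> cmeasurable (fun x => conjc (f x)).
Proof.
move=> [f1 f2]; split.
- rewrite [X in measurable_fun _ X](_ : _ = (fun x => complex.Re (f x)))//.
  by apply/funext => x; case: (f x).
- rewrite [X in measurable_fun _ X](_ : _ = (fun x => - complex.Im (f x))).
    exact: measurable_funN.
  by apply/funext => x; case: (f x).
Qed.

Lemma cmeasurable_sum (I : Type) (s : seq I) (h : I -> T -> R[i]) :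
  (forall i, cmeasurable (h i)) -> cmeasurable (fun x => \sum_(i <- s) h i x).
Proof.
move=> mh; elim: s => [|i s ih].
  under eq_fun do rewrite big_nil; exact: cmeasurable_cst.
under eq_fun do rewrite big_cons; exact: cmeasurableD.
Qed.

Lemma measurable_sqmod f : cmeasurable f ->
  measurable_fun setT (fun x => (sqmod (f x))%:E).
Proof.
move=> [f1 f2]; apply/measurable_EFinP.
under eq_fun do rewrite sqmodE.
by apply: measurable_funD; exact: measurable_funX.
Qed.
End cmeasurable_theory.

Lemma cmeasurable_comp d d' (T : measurableType d) (T' : measurableType d')
    (f : T -> R[i]) (p : T' -> T) : cmeasurable f -> measurable_fun setT p ->
  cmeasurable (fun x => f (p x)).
Proof.
move=> [f1 f2] mp; split.
- exact: (measurableT_comp f1 mp).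
- exact: (measurableT_comp f2 mp).
Qed.

Lemma cmeasurable_expi d (T : measurableType d) (phi : T -> R) :
  measurable_fun setT phi -> cmeasurable (fun x => expi (phi x)).
Proof.
move=> mphi; split => /=.
- apply: (@measurableT_comp _ _ _ _ _ _ (@cos R)) mphi.
  by apply: measurable_realfun.continuous_measurable_fun; exact: continuous_cos.
- apply: (@measurableT_comp _ _ _ _ _ _ (@sin R)) mphi.
  by apply: measurable_realfun.continuous_measurable_fun; exact: continuous_sin.
Qed.

Lemma cmeasurable_exp1 (l : R) : cmeasurable (@exp1 R l).
Proof.
by apply: cmeasurable_expi; apply: measurable_funM => //; exact: measurable_funM.
Qed.

Lemma cmeasurable_exp2 (l : R * R) : cmeasurable (@exp2 R l).
Proof.
apply: cmeasurable_expi.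
by do ?[apply: measurable_funM => //|apply: measurable_funD].
Qed.

Lemma expiD (s t : R) : expi (s + t) = expi s * expi t.
Proof.
by rewrite /expi cosD sinD; congr (_ +i* _); rewrite addrC [X in X + _]mulrC.
Qed.

Lemma sqmod_expi (t : R) : sqmod (expi t) = 1.
Proof. by rewrite sqmodE /= cos2Dsin2. Qed.

(** The distance to 1 on the circle is a decreasing function of the cosine,
    which is what makes the monotonicity of cos on [0, pi] usable. *)
Lemma sqmod_expiB1 (t : R) : sqmod (expi t - 1) = 2 - 2 * cos t.
Proof.
rewrite sqmodE /=; have := cos2Dsin2 t; nra.
Qed.
End complex_valued.

(** * Squared norms in L2 *)
Section norms.
Local Open Scope complex_scope.
Context d (T : measurableType d) (R : realType).
Variable sigma : {measure set T -> \bar R}.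
Implicit Types f g : T -> R[i].

Lemma L2normsq_ge0 f : (0 <= L2normsq sigma f)%E.
Proof. by apply: integral_ge0 => x _; rewrite lee_fin sqmod_ge0. Qed.

Lemma L2normsq_pair_le (u v h k : T -> R[i]) (K : R) : 0 <= K ->
  cmeasurable u -> cmeasurable v -> cmeasurable h -> cmeasurable k ->
  (\forall x \ae sigma,
     sqmod (u x) + sqmod (v x) <= K * (sqmod (h x) + sqmod (k x))) ->
  (L2normsq sigma u + L2normsq sigma v
    <= K%:E * (L2normsq sigma h + L2normsq sigma k))%E.
Proof.
move=> K0 mu_ mv mh mk le_uvhk.
have pos f : forall x, setT x -> (0 <= (sqmod (f x))%:E)%E.
  by move=> x _; rewrite lee_fin sqmod_ge0.
rewrite /L2normsq -!ge0_integralD//; try exact: measurable_sqmod; try exact: pos.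
rewrite -ge0_integralZl//; first last.
- by move=> x _; apply: adde_ge0; exact: pos.
- by apply: emeasurable_funD; exact: measurable_sqmod.
apply: ae_ge0_le_integral => //.
- by move=> x _; apply: adde_ge0; exact: pos.
- by apply: emeasurable_funD; exact: measurable_sqmod.
- by move=> x _; apply: mule_ge0 => //; apply: adde_ge0; exact: pos.
- apply: measurable_funeM; apply: emeasurable_funD; exact: measurable_sqmod.
by apply: filterS le_uvhk => x + _; rewrite -!EFinD -EFinM lee_fin.
Qed.

Lemma L2normsqZ (k : R[i]) (f : T -> R[i]) : cmeasurable f ->
  L2normsq sigma (fun x => k * f x) = ((sqmod k)%:E * L2normsq sigma f)%E.
Proof.
move=> mf; rewrite /L2normsq -ge0_integralZl ?lee_fin ?sqmod_ge0//.
- by apply: eq_integral => x _; rewrite sqmodM EFinM.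
- exact: measurable_sqmod.
- by move=> x _; rewrite lee_fin sqmod_ge0.
Qed.

Lemma L2normsq_vandermonde (m u v : T -> R[i]) (c : R) :
  cmeasurable m -> cmeasurable u -> cmeasurable v ->
  (forall x, sqmod (m x) = 1) -> 0 < c ->
  (\forall x \ae sigma, c <= sqmod (m x - 1)) ->
  let D := (L2normsq sigma (fun x => u x + v x)%R
            + L2normsq sigma (fun x => u x + m x * v x)%R)%E in
  (D <= 4%:E * (L2normsq sigma u + L2normsq sigma v))%E /\
  (L2normsq sigma u + L2normsq sigma v <= (2 + 6 / c)%:E * D)%E.
Proof.
move=> mm mu_ mv m1 c0 cm D.
have muv := cmeasurableD mu_ mv.
have mumv := cmeasurableD mu_ (cmeasurableM mm mv).
have K0 : 0 <= 2 + 6 / c by rewrite addr_ge0// divr_ge0// ltW.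
split; apply: L2normsq_pair_le => //.
- by apply: aeW => x; exact: sqmod_vandermonde_le.
- by apply: filterS cm => x; exact: sqmod_le_vandermonde.
Qed.
End norms.

(** * Integration against the additive measure *)
Section additive_integral.
Local Open Scope complex_scope.
Variables (R : realType) (mu : probability R R).
Local Notation rho := (additive_measure mu).

Lemma measurable_pairl0 : measurable_fun setT (fun x : R => (x, 0 : R)).
Proof. exact: pair2_measurable. Qed.

Lemma measurable_pairr0 : measurable_fun setT (fun x : R => (0 : R, x)).
Proof. exact: pair1_measurable. Qed.

Local Open Scope ereal_scope.

Lemma ge0_integral_additive (H : R * R -> \bar R) :
  measurable_fun setT H -> (forall p, 0 <= H p) ->
  \int[rho]_p H p = \int[mu]_x ((2^-1)%:E * (H (x, 0%R) + H (0%R, x))).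
Proof.
move=> mH H0.
have mHl := measurableT_comp mH measurable_pairl0.
have mHr := measurableT_comp mH measurable_pairr0.
transitivity ((2^-1)%:E * (\int[mu \x \d_(0%R : R)]_p H p
                          + \int[\d_(0%R : R) \x mu]_p H p)).
  rewrite -(@ge0_integral_measure_add _ _ _ (mu \x \d_(0%R : R))
    (\d_(0%R : R) \x mu) setT measurableT H (fun p _ => H0 p) mH).
  exact: (ge0_integral_mscale
    (measure_add (mu \x \d_(0%R : R)) (\d_(0%R : R) \x mu)) measurableT
    ((2^-1 : R)%:nng)%R mH (fun p _ => H0 p)).
rewrite fubini_tonelli1// fubini_tonelli2//.
rewrite ge0_integralZl//; first last.
- by move=> x _; exact: adde_ge0.
- exact: emeasurable_funD.
rewrite ge0_integralD//; congr (_ * (_ + _)); apply: eq_integral => x _.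
- rewrite /fubini_F integral_dirac// ?diracT ?mul1e//.
  exact: measurableT_comp (pair1_measurable x).
- rewrite /fubini_G integral_dirac// ?diracT ?mul1e//.
  exact: measurableT_comp (pair2_measurable x).
Qed.

Lemma L2normsq_additive (F : R * R -> R[i]) : cmeasurable F ->
  L2normsq rho F = (2^-1)%:E * (L2normsq mu (fun x => F (x, 0%R))
                                + L2normsq mu (fun x => F (0%R, x))).
Proof.
move=> mF.
have mFl := cmeasurable_comp mF measurable_pairl0.
have mFr := cmeasurable_comp mF measurable_pairr0.
have pos (f : R -> R[i]) x : setT x -> 0 <= (sqmod (f x))%:E.
  by rewrite lee_fin sqmod_ge0.
rewrite /L2normsq ge0_integral_additive//; last first.
- by move=> p; rewrite lee_fin sqmod_ge0.
- exact: measurable_sqmod.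
rewrite ge0_integralZl//; first last.
- by move=> x _; apply: adde_ge0; rewrite lee_fin sqmod_ge0.
- by apply: emeasurable_funD; exact: measurable_sqmod.
by rewrite ge0_integralD//; try exact: pos; exact: measurable_sqmod.
Qed.

(** On a probability space L2 is contained in L1, because |t| <= t^2 + 1; the
    inner products below are thus genuine integrals. *)
Lemma integrable_Re_Im (w : R -> R[i]) : L2 mu w ->
  mu.-integrable setT (EFin \o (fun x => complex.Re (w x))) /\
  mu.-integrable setT (EFin \o (fun x => complex.Im (w x))).
Proof.
move=> [m1 m2 fin].
have mw : cmeasurable w by [].
have dom : mu.-integrable setT (fun x => (sqmod (w x))%:E + 1).
  apply: integrableD => //.
    apply/integrableP; split; first exact: measurable_sqmod.
    under eq_integral do rewrite gee0_abs ?lee_fin ?sqmod_ge0//.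
    exact: fin.
  exact: finite_measure_integrable_cst.
have le1 (t s : R) : (`|t| <= `|(t ^+ 2 + s ^+ 2) + 1|)%R.
  have t2 := sqr_ge0 t; have s2 := sqr_ge0 s.
  rewrite [leRHS]ger0_norm; last by lra.
  by rewrite ler_norml; have := sqr_ge0 (t - 1)%R; have := sqr_ge0 (t + 1)%R;
    move=> *; apply/andP; split; nra.
split; apply: le_integrable dom => //; try exact/measurable_EFinP.
- by move=> x _; rewrite sqmodE -EFinD lee_fin; exact: le1.
- by move=> x _; rewrite sqmodE [X in X%:E + _]addrC -EFinD lee_fin; exact: le1.
Qed.

(** Positive and negative parts are treated separately by
    [ge0_integral_additive]; integrability of the two slices is what allows
    the two results to be subtracted. *)
Lemma Rintegral_additive (G : R * R -> R) : measurable_fun setT G ->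
  mu.-integrable setT (EFin \o (fun x => G (x, 0%R))) ->
  mu.-integrable setT (EFin \o (fun x => G (0%R, x))) ->
  (\int[rho]_p G p = \int[mu]_x (2^-1 * (G (x, 0) + G (0, x))))%R.
Proof.
move=> mG il ir; rewrite /Rintegral; congr fine.
have mE : measurable_fun setT (EFin \o G) by exact/measurable_EFinP.
rewrite integralE !ge0_integral_additive//; first last.
- exact: measurable_funepos.
- exact: measurable_funeneg.
have half (a b : R -> \bar R) : mu.-integrable setT a -> mu.-integrable setT b ->
    mu.-integrable setT (fun x => (2^-1)%:E * (a x + b x)).
  by move=> ia ib; apply: integrableZl => //; exact: integrableD.
have slice (s : R -> R * R) : mu.-integrable setT (EFin \o (fun x => G (s x))) ->
    mu.-integrable setT (fun x => (EFin \o G)^\+ (s x)) /\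
    mu.-integrable setT (fun x => (EFin \o G)^\- (s x)).
  move=> i; split.
  - rewrite [X in _.-integrable _ X](_ : _ = (EFin \o (fun x => G (s x)))^\+).
      exact: integrable_funepos.
    by apply/funext => x; rewrite !funeposE.
  - rewrite [X in _.-integrable _ X](_ : _ = (EFin \o (fun x => G (s x)))^\-).
      exact: integrable_funeneg.
    by apply/funext => x; rewrite !funenegE.
rewrite -integralB//.
- apply: eq_integral => x _ /=; rewrite !funeposE !funenegE.
  rewrite -!EFinN -!EFin_max -!EFinD; congr EFin.
  have pn (t : R) : (Num.max t 0 = Num.max (- t) 0 + t)%R.
    by rewrite !maxEle; case: ifP; case: ifP; lra.
  rewrite (pn (G (x, 0%R))) (pn (G (0%R, x))).
  by field.
- exact: half (slice _ il).1 (slice _ ir).1.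
- exact: half (slice _ il).2 (slice _ ir).2.
Qed.

(** The factor 1/2 is kept inside the integrand: an inner product in L2(rho)
    then appears as one inner product in L2(mu), with no constant to move
    through the sums over frequencies. *)
Lemma cintegral_additive (G : R * R -> R[i]) : cmeasurable G ->
  L2 mu (fun x => G (x, 0%R)) -> L2 mu (fun x => G (0%R, x)) ->
  cintegral rho G =
    cintegral mu (fun x => (2^-1)%:C * (G (x, 0) + G (0, x)))%R.
Proof.
move=> [mRe mIm] /integrable_Re_Im[iRel iIml] /integrable_Re_Im[iRer iImr].
rewrite /cintegral; congr (_ +i* _)%C; rewrite Rintegral_additive//.
- apply: eq_Rintegral => x _.
  by case: (G (x, 0%R)) (G (0%R, x)) => a b [a' b'] /=; ring.
- apply: eq_Rintegral => x _.
  by case: (G (x, 0%R)) (G (0%R, x)) => a b [a' b'] /=; ring.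
Qed.
End additive_integral.

(** * The support of the measure and the choice of the shift *)
Section support.
Variables (R : realType) (mu : {measure set R -> \bar R}).

(** A point outside the support has a null neighbourhood, hence lies in a null
    interval with rational endpoints, and there are countably many of these. *)
Lemma ae_msupport : \forall x \ae mu, msupport mu x.
Proof.
pose I (q : rat * rat) : set R := [set` `]ratr q.1, ratr q.2[].
(* The null rational intervals, enumerated, with set0 as filler. *)
pose N n := if unpickle n is Some q then
              if mu (I q) == 0%E then I q else set0 else set0.
suff : mu.-negligible (\bigcup_n N n).
  apply: negligibleS => x /= /existsNP[U] /not_implyP[oU] /not_implyP[Ux].
  move=> /negP; rewrite -leNgt => muU.
  have /nbhs_ballP[e /= e0 eU] := open_nbhs_nbhs (conj oU Ux).
  have [a] : exists q : rat, ratr q \in `]x - e, x[ by apply: rat_in_itvoo; lra.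
  have [b] : exists q : rat, ratr q \in `]x, x + e[ by apply: rat_in_itvoo; lra.
  rewrite !in_itv /= => /andP[xb be] /andP[ea ax].
  have subU : I (a, b) `<=` U.
    move=> y; rewrite /I /= in_itv /= => /andP[ay yb]; apply: eU.
    by rewrite /ball/= ltr_norml; lra.
  exists (pickle (a, b)); first exact: Logic.I.
  rewrite /N pickleK ifT.
    by rewrite /I /= in_itv /= ax xb.
  rewrite eq_le measure_ge0 andbT; apply: le_trans muU.
  apply: le_measure; rewrite ?inE//.
  - exact: measurable_itv.
  - exact: open_measurable.
apply: negligible_bigcup => n; rewrite /N.
case: unpickle => [q|]; last exact: negligible_set0.
case: ifP => [/eqP q0|_]; last exact: negligible_set0.
by exists (I q); split => //; exact: measurable_itv.
Qed.

(** The support lies in e <= |x| <= M.  With tau = 1 / (2 M), the phase of e_tau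
    at x is pi x / M, of absolute value in [pi e / M, pi], where cos is
    decreasing. *)
Lemma separating_frequency : compact (msupport mu) -> ~ msupport mu 0 ->
  exists2 tau : R, tau != 0 &
    exists2 c : R, 0 < c &
      forall x, msupport mu x -> c <= sqmod (@exp1 R tau x - 1).
Proof.
move=> /compact_bounded[M0 [_ bounded]] /existsNP[U] /not_implyP[oU] /not_implyP[U0 muU].
have /nbhs_ballP[e /= e0 eU] := open_nbhs_nbhs (conj oU U0).
have away x : msupport mu x -> e <= `|x|.
  move=> sx; rewrite leNgt; apply/negP => xe; apply: muU; apply: sx => //.
  by apply: eU; rewrite /ball/= sub0r normrN.
(* M0 + 1 because boundedness only controls |x| by numbers above M0; the
   maximum with e makes M positive and puts e in the range of [thin]. *)
pose M := Num.max (M0 + 1) e.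
have M_gt0 : 0 < M by rewrite lt_max e0 orbT.
have below x : msupport mu x -> `|x| <= M.
  by apply: bounded; rewrite lt_max ltrDl ltr01.
have eM : e <= M by rewrite le_max lexx orbT.
have p0 := pi_gt0 R.
have q0 : 0 < pi / M * e by rewrite mulr_gt0// divr_gt0.
have thin x : 0 <= x -> x <= M -> pi / M * x \in `[0, pi].
  move=> x0 xM; rewrite in_itv /=; apply/andP; split.
    by rewrite mulr_ge0// divr_ge0// ltW.
  by rewrite mulrAC ler_pdivrMr// ler_wpM2l// ltW.
exists (2 * M)^-1; first by rewrite invr_eq0 mulf_neq0// gt_eqF.
exists (2 - 2 * cos (pi / M * e)).
  have : cos (pi / M * e) < cos 0.
    by rewrite ltr_cos ?thin ?(ltW e0)// in_itv /= lexx ltW.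
  by rewrite cos0; lra.
move=> x sx; rewrite /exp1 sqmod_expiB1.
have -> : 2 * pi * ((2 * M)^-1 * x) = pi / M * x by field; rewrite gt_eqF.
have := away x sx; have := below x sx; have x0 := normr_ge0 x => xM ex.
suff : cos (pi / M * x) <= cos (pi / M * e) by lra.
rewrite -[leLHS]cos_norm normrM (ger0_norm (ltW (divr_gt0 p0 M_gt0))).
by rewrite leNgt ltr_cos ?thin ?(ltW e0)// -leNgt ler_pM2l// divr_gt0.
Qed.
End support.

(** * The sumset of frequencies *)
Lemma esum_setU (R : realType) (T : choiceType) (A B : set T) (a : T -> \bar R) :
  (forall i, 0 <= a i)%E -> A `&` B = set0 ->
  (\esum_(i in A `|` B) a i = \esum_(i in A) a i + \esum_(i in B) a i)%E.
Proof.
move=> a0 AB; rewrite esum_mkcond [in RHS]esum_mkcond [X in (_ + X)%E]esum_mkcond.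
rewrite -esumD; try by move=> i _; case: ifP.
apply: eq_esum => i _; rewrite in_setU.
case: (boolP (i \in A)) => iA; case: (boolP (i \in B)) => iB /=;
  rewrite ?adde0 ?add0e//.
by move/seteqP: AB => [/(_ i)+ _]; case; split; exact: set_mem.
Qed.

(** [fsbigU] wants finite index sets; here only the support is finite, so the
    three sums are first restricted to it. *)
Lemma fsum_setU (V : zmodType) (T : choiceType) (A B : set T) (F : T -> V) :
  finite_set ((A `|` B) `&` [set i | F i != 0]) -> A `&` B = set0 ->
  \sum_(i \in A `|` B) F i = \sum_(i \in A) F i + \sum_(i \in B) F i.
Proof.
move=> fin AB.
have suppE (D : set T) : \sum_(i \in D) F i = \sum_(i \in D `&` [set i | F i != 0]) F i.
  rewrite fsbig_supp; apply: eq_fsbigl; congr (_ `&` _).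
  by apply/seteqP; split => i /= /eqP.
rewrite suppE (suppE A) (suppE B) setIUl fsbigU0//.
- by apply: sub_finite_set fin; apply: setSI; left.
- by apply: sub_finite_set fin; apply: setSI; right.
- by rewrite setIACA AB set0I.
Qed.

Section diagonal.
Variables (R : realType).

(** The frequency set of the theorem is the union of the images of [diag 0] and
    [diag tau]; regarding (l, l) as a shift by 0 lets one lemma handle both
    halves. *)
Definition diag (t l : R) : R * R := (l, l + t).

Lemma diag_inj t : injective (diag t).
Proof. by move=> l l' [->]. Qed.

Lemma diag_disjoint (t : R) (L : set R) : t != 0 ->
  diag 0 @` L `&` diag t @` L = set0.
Proof.
move=> t0; apply/seteqP; split => // p [[l _ <-] [l' _ []]] -> /addrI.
by move/eqP; rewrite (negPf t0).
Qed.

Lemma diag_sumset (t : R) (L : set R) :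
  [set p + q | p in [set (l, l) | l in L] & q in [set (0, 0); (0, t)]] =
  diag 0 @` L `|` diag t @` L.
Proof.
apply/seteqP; split => p /=.
- move=> [_ [l Ll <-]] [q + <-] => -[->|->]; [left|right]; exists l => //;
  by rewrite /diag; congr pair; rewrite /= addr0.
- move=> [] [l Ll <-]; exists (l, l); try by exists l.
  + by exists (0, 0); [left|rewrite /diag; congr pair; rewrite /= addr0].
  + by exists (0, t); [right|rewrite /diag; congr pair; rewrite /= addr0].
Qed.

Lemma exp2_diagl (t l x : R) : exp2 (diag t l) (x, 0) = exp1 l x.
Proof. by rewrite /exp2 /exp1 /= mulr0 addr0. Qed.

Lemma exp2_diagr (t l x : R) : exp2 (diag t l) (0, x) = exp1 t x * exp1 l x.
Proof. by rewrite /exp2 /exp1 -expiD /=; congr expi; ring. Qed.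

Lemma exp1_0 (x : R) : exp1 0 x = 1.
Proof. by rewrite /exp1 mul0r mulr0 /expi cos0 sin0. Qed.

Lemma esum_diag (t : R) (L : set R) (a : R * R -> \bar R) : t != 0 ->
  (forall p, 0 <= a p)%E ->
  (\esum_(p in diag 0 @` L `|` diag t @` L) a p =
   \esum_(l in L) a (diag 0 l) + \esum_(l in L) a (diag t l))%E.
Proof.
move=> t0 a0; rewrite esum_setU//; last exact: diag_disjoint.
by congr (_ + _)%E; apply: reindex_esum; apply: inj_bij => ? ? _ _; exact: diag_inj.
Qed.

Lemma fsum_diag (V : zmodType) (t : R) (L : set R) (F : R * R -> V) : t != 0 ->
  finite_set ((diag 0 @` L `|` diag t @` L) `&` [set p | F p != 0]) ->
  \sum_(p \in diag 0 @` L `|` diag t @` L) F p =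
  \sum_(l \in L) F (diag 0 l) + \sum_(l \in L) F (diag t l).
Proof.
move=> t0 fin; rewrite fsum_setU//; last exact: diag_disjoint.
by congr (_ + _); apply: fsbig_image => ? ? _ _; exact: diag_inj.
Qed.
End diagonal.

(** * Frame and Riesz bounds for the additive measure *)
Section synthesis.
Local Open Scope complex_scope.
Context d (T : measurableType d) (R : realType) (I : choiceType).
Variables (e : I -> T -> R[i]) (L : set I).

Definition synth (a : I -> R[i]) (x : T) : R[i] := \sum_(l \in L) a l * e l x.

(** The set of indices actually summed at x depends on x, through the zeros of
    a l * e l x; restricting to the support of a gives a fixed finite sum. *)
Lemma cmeasurable_synth (a : I -> R[i]) : (forall l, cmeasurable (e l)) ->
  finite_set (L `&` [set l | a l != 0]) -> cmeasurable (synth a).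
Proof.
move=> me fin; have -> : synth a =
    (fun x => \sum_(l <- finmap.enum_fset (fset_set (L `&` [set l | a l != 0])))
              a l * e l x).
  apply/funext => x; rewrite -fsbig_finite//; apply/esym/fsbig_widen.
    by move=> l [].
  move=> l [Ll] /not_andP[//|/negP]; rewrite negbK => /eqP al.
  by rewrite /= al mul0r.
apply: cmeasurable_sum => l.
exact: cmeasurableM (cmeasurable_cst _ _) (me l).
Qed.
End synthesis.

Section frame.
Local Open Scope complex_scope.
Variables (R : realType) (mu : probability R R).
Local Notation rho := (additive_measure mu).
Local Notation N := (L2normsq mu).

Lemma L2_slices (F : R * R -> R[i]) : L2 rho F ->
  L2 mu (fun x => F (x, 0)) /\ L2 mu (fun x => F (0, x)).
Proof.
move=> [m1 m2]; have mF : cmeasurable F by [].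
have [l1 l2] := cmeasurable_comp mF (@measurable_pairl0 R).
have [r1 r2] := cmeasurable_comp mF (@measurable_pairr0 R).
rewrite L2normsq_additive// => fin.
have {}fin : (N (fun x => F (x, 0%R)) + N (fun x => F (0%R, x)) < +oo)%E.
  move: fin; rewrite !ltey; apply: contra => /eqP ->.
  by rewrite mulry gtr0_sg ?mul1e// invr_gt0.
have lf := L2normsq_ge0 mu (fun x => F (x, 0)).
have rf := L2normsq_ge0 mu (fun x => F (0, x)).
by split; split => //; apply: le_lt_trans fin; [rewrite leeDl|rewrite leeDr].
Qed.

(** Up to normalization, a component of the adjoint Vandermonde matrix applied
    to the pair of slices of F. *)
Definition folded (F : R * R -> R[i]) (t x : R) : R[i] :=
  (2^-1)%:C * (F (x, 0) + conjc (exp1 t x) * F (0, x)).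

Lemma L2_unimodular (f e : R -> R[i]) : cmeasurable e ->
  (forall x, sqmod (e x) = 1) -> L2 mu f -> L2 mu (fun x => f x * e x).
Proof.
move=> me e1 [m1 m2 fin]; have mf : cmeasurable f by [].
have [p1 p2] := cmeasurableM mf me; split => //.
rewrite /L2normsq; under eq_integral do rewrite sqmodM e1 mulr1.
exact: fin.
Qed.

Lemma L2inner_diag (F : R * R -> R[i]) (t l : R) : L2 rho F ->
  L2inner rho F (exp2 (diag t l)) = L2inner mu (folded F t) (exp1 l).
Proof.
move=> LF; have [Lf Lg] := L2_slices LF.
have mF : cmeasurable F by case: LF.
have uni p x : sqmod (conjc (@exp2 R p x)) = 1 by rewrite sqmodJ sqmod_expi.
have me := cmeasurableJ (cmeasurable_exp2 (diag t l)).
rewrite /L2inner cintegral_additive; first last.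
- exact: L2_unimodular (cmeasurable_comp me (@measurable_pairr0 R)) _ Lg.
- exact: L2_unimodular (cmeasurable_comp me (@measurable_pairl0 R)) _ Lf.
- exact: cmeasurableM.
congr cintegral; apply/funext => x.
by rewrite exp2_diagl exp2_diagr rmorphM /folded; ring.
Qed.

(** By [L2inner_diag] the sum over the frequencies is the sum of the two frame
    sums of [folded F 0] and [folded F tau], so it is comparable to the sum of
    their squared norms, which is comparable to the squared norm of F by
    [L2normsq_vandermonde] applied to the conjugate of e_tau. *)
Lemma frame_additive (L : set R) (tau c : R) : tau != 0 -> 0 < c ->
  (\forall x \ae mu, c <= sqmod (exp1 tau x - 1)) ->
  is_frame (@exp1 R) mu L ->
  is_frame (@exp2 R) rho (diag 0 @` L `|` diag tau @` L).
Proof.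
move=> tau0 c0 sep [A [B [A0 B0 fr]]].
pose K := 2 + 6 / c.
have K0 : 0 < K by rewrite addr_gt0// divr_gt0.
(* The sum of the squared norms of the folded functions is at most that of the
   slices, hence 2 B; it is at least 1 / (4 K) times the latter, hence
   A / (2 K): the squared norm of F is half the sum for the slices. *)
exists (A / (2 * K)), (2 * B); split; rewrite ?mulr_gt0 ?invr_gt0 ?mulr_gt0//.
move=> F LF; have [Lf Lg] := L2_slices LF.
have mF : cmeasurable F by case: LF.
have mf := cmeasurable_comp mF (@measurable_pairl0 R).
have mg := cmeasurable_comp mF (@measurable_pairr0 R).
rewrite esum_diag//; last by move=> p; rewrite lee_fin sqmod_ge0.
under eq_esum do rewrite L2inner_diag//.
under [X in (_ <= _ + X <= _)%E]eq_esum do rewrite L2inner_diag//.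
rewrite L2normsq_additive//.
have mfold t : cmeasurable (folded F t).
  apply: cmeasurableM (cmeasurable_cst _ _) (cmeasurableD mf _).
  exact: cmeasurableM (cmeasurableJ (cmeasurable_exp1 t)) mg.
have sepJ : \forall x \ae mu, c <= sqmod (conjc (exp1 tau x) - 1).
  apply: filterS sep => x; congr (c <= _).
  by rewrite -[LHS]sqmodJ rmorphB rmorph1.
have := L2normsq_vandermonde (cmeasurableJ (cmeasurable_exp1 tau)) mf mg _ c0 sepJ.
have uni x : sqmod (conjc (exp1 tau x)) = 1 by rewrite sqmodJ sqmod_expi.
move=> /(_ uni) [].
have quarter t : N (folded F t) =
    ((4^-1)%:E * N (fun x => F (x, 0)%R + conjc (exp1 t x) * F (0, x)%R)%R)%E.
  rewrite /folded L2normsqZ; last first.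
    apply: cmeasurableD => //.
    exact: cmeasurableM (cmeasurableJ (cmeasurable_exp1 t)) mg.
  by congr (_%:E * _)%E; rewrite sqmodE /=; field.
have fold0 : N (fun x => F (x, 0)%R + F (0, x)%R)%R = (4%:E * N (folded F 0))%E.
  rewrite quarter muleA -EFinM divff// mul1e; congr N; apply/funext => x.
  by rewrite exp1_0 conjc1 mul1r.
have foldtau : N (fun x => F (x, 0)%R + conjc (exp1 tau x) * F (0, x)%R)%R
    = (4%:E * N (folded F tau))%E.
  by rewrite quarter muleA -EFinM divff// mul1e.
rewrite fold0 foldtau -/K.
have fin_L2 f : L2 mu f -> N f = (fine (N f))%:E.
  by move=> [_ _ fin]; rewrite fineK// ge0_fin_numE// L2normsq_ge0.
(* The upper bound shows that the folded functions are in L2(mu), so that the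
   remaining inequalities are between real numbers. *)
rewrite (fin_L2 _ Lf) (fin_L2 _ Lg) => up low.
have : (4%:E * N (folded F 0) + 4%:E * N (folded F tau) < +oo)%E.
  exact: le_lt_trans up (ltry _).
have n0_ge0 := L2normsq_ge0 mu (folded F 0).
have ntau_ge0 := L2normsq_ge0 mu (folded F tau).
have fin4 (x : \bar R) : (4%:E * x < +oo -> x < +oo)%E.
  by rewrite !ltey; apply: contra => /eqP ->; rewrite mulry gtr0_sg ?mul1e.
move=> fin.
have L0 : L2 mu (folded F 0).
  have [m1 m2] := mfold 0; split=> //; apply: fin4; apply: le_lt_trans fin.
  by rewrite leeDl// mule_ge0.
have Ltau : L2 mu (folded F tau).
  have [m1 m2] := mfold tau; split=> //; apply: fin4; apply: le_lt_trans fin.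
  by rewrite leeDr// mule_ge0.
have /andP := fr _ L0; have /andP := fr _ Ltau.
move: up low; rewrite (fin_L2 _ L0) (fin_L2 _ Ltau).
case: (\esum_(i in L) _)%E => [s1| |] + + [] //.
case: (\esum_(i in L) _)%E => [s0| |] + + + + [] //.
rewrite -?EFinM -?EFinD -?EFinM !lee_fin.
set n0 := fine _; set n1 := fine _; set nf := fine _; set ng := fine _.
move=> up low lo1 hi1 lo0 hi0.
have AK0 : 0 <= A / (4 * K) by rewrite divr_ge0 ?mulr_ge0// ltW.
have lowA := ler_wpM2l AK0 low.
have hiB : B * (n0 + n1) <= B * (nf + ng) by rewrite ler_wpM2l ?(ltW B0)//; lra.
apply/andP; split.
- apply: le_trans (lerD lo0 lo1); apply: le_trans (le_trans _ lowA) _.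
    by rewrite le_eqVlt; apply/orP; left; apply/eqP; field; rewrite gt_eqF.
  by rewrite le_eqVlt; apply/orP; left; apply/eqP; field; rewrite gt_eqF.
- lra.
Qed.

(** With S0 and S1 the sums of exponentials built on the diagonal and on the
    shifted diagonal coefficients, the slices of the sum over the plane are
    S0 + S1 and S0 + e_tau S1. *)
Lemma riesz_additive (L : set R) (tau c : R) : tau != 0 -> 0 < c ->
  (\forall x \ae mu, c <= sqmod (exp1 tau x - 1)) ->
  riesz_bounds (@exp1 R) mu L ->
  riesz_bounds (@exp2 R) rho (diag 0 @` L `|` diag tau @` L).
Proof.
move=> tau0 c0 sep [A [B [A0 B0 rz]]].
pose K := 2 + 6 / c.
have K0 : 0 < K by rewrite addr_gt0// divr_gt0.
(* The bounds 4 and 1 / K of [L2normsq_vandermonde], halved because of the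
   factor 1 / 2 in the norm of L2(rho). *)
exists (A / (2 * K)), (2 * B); split; rewrite ?mulr_gt0 ?invr_gt0 ?mulr_gt0//.
set Lr := _ `|` _.
move=> b finb.
pose a t l := b (diag t l).
have fina t : [set diag t l | l in L] `<=` Lr ->
    finite_set (L `&` [set l | a t l != 0]).
  move=> tL; apply: (@sub_finite_set _ _ (diag t @^-1` (Lr `&` [set p | b p != 0]))).
    by move=> l [Ll al]; split => //; apply: tL; exists l.
  by apply: finite_preimage finb => ? ? _ _; exact: diag_inj.
have fina0 : finite_set (L `&` [set l | a 0 l != 0]) by apply: fina; left.
have fina1 : finite_set (L `&` [set l | a tau l != 0]) by apply: fina; right.
have splitE (z : R * R) : \sum_(p \in Lr) b p * exp2 p z =
    \sum_(l \in L) a 0 l * exp2 (diag 0 l) z +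
    \sum_(l \in L) a tau l * exp2 (diag tau l) z.
  rewrite fsum_diag//; apply: sub_finite_set finb => p [Lp] /=.
  by rewrite mulf_eq0 negb_or => /andP[].
have sumE : \sum_(p \in Lr) sqmod (b p) =
    \sum_(l \in L) sqmod (a 0 l) + \sum_(l \in L) sqmod (a tau l).
  rewrite fsum_diag//; apply: sub_finite_set finb => p [Lp] /=.
  move=> bp; split => //; apply: contra bp => /eqP ->.
  by rewrite sqmodE /= expr0n addr0.
have mS0 := cmeasurable_synth (@cmeasurable_exp1 R) fina0.
have mS1 := cmeasurable_synth (@cmeasurable_exp1 R) fina1.
have sliceL x : \sum_(p \in Lr) b p * exp2 p (x, 0) =
    synth (@exp1 R) L (a 0) x + synth (@exp1 R) L (a tau) x.
  rewrite splitE; congr (_ + _); apply: eq_fsbigr => l _;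
  by rewrite exp2_diagl.
have sliceR x : \sum_(p \in Lr) b p * exp2 p (0, x) =
    synth (@exp1 R) L (a 0) x + exp1 tau x * synth (@exp1 R) L (a tau) x.
  rewrite splitE /synth mulr_fsumr; congr (_ + _); apply: eq_fsbigr => l _;
  by rewrite exp2_diagr ?exp1_0 ?mul1r// mulrCA.
have -> : L2normsq rho (fun z => \sum_(p \in Lr) b p * exp2 p z) =
    ((2^-1)%:E
     * (N (fun x => synth (@exp1 R) L (a 0) x + synth (@exp1 R) L (a tau) x)%R
        + N (fun x => synth (@exp1 R) L (a 0) x
                      + exp1 tau x * synth (@exp1 R) L (a tau) x)%R))%E.
  rewrite L2normsq_additive; last first.
    by apply: cmeasurable_synth => // p; exact: cmeasurable_exp2.
  by congr (_ * (L2normsq mu _ + L2normsq mu _))%E; apply/funext => x;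
    [exact: sliceL|exact: sliceR].
have uni x : sqmod (@exp1 R tau x) = 1 by exact: sqmod_expi.
have := L2normsq_vandermonde (cmeasurable_exp1 tau) mS0 mS1 uni c0 sep.
rewrite -/K sumE /=.
have /andP := rz _ fina0; have /andP := rz _ fina1.
rewrite -!/(synth _ _ _).
have X0_ge0 := L2normsq_ge0 mu (synth (@exp1 R) L (a 0)).
have X1_ge0 := L2normsq_ge0 mu (synth (@exp1 R) L (a tau)).
set D := (L2normsq mu _ + L2normsq mu _)%E.
have : (0 <= D)%E by rewrite adde_ge0// L2normsq_ge0.
(* Infinite values are excluded by the upper bounds. *)
case: (L2normsq mu (synth _ _ (a 0))) X0_ge0 => [x0| |]//= _;
  case: (L2normsq mu (synth _ _ (a tau))) X1_ge0 => [x1| |]//= _;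
  try by move=> _ [] _ //; move=> _ [] _ //.
case: D => [D| |] //; last by move=> _ _ _ [].
set s0 := \sum_(l \in L) _; set s1 := \sum_(l \in L) _.
rewrite -?EFinM -?EFinD -?EFinM !lee_fin.
move=> _ [lo1 hi1] [lo0 hi0] [up low].
apply/andP; split; last lra.
rewrite -ler_pdivlMl ?divr_gt0 ?mulr_gt0//.
have -> : (A / (2 * K))^-1 * (2^-1 * D) = A^-1 * (K * D).
  by field; rewrite !gt_eqF.
by rewrite ler_pdivlMl//; lra.
Qed.
End frame.

Theorem theorem1p1 (R : realType) (mu : probability R R)
    (mu_continuous : continuous_measure mu)
    (mu_compact : compact (msupport mu))
    (mu_supp0 : ~ msupport mu 0) :
  (forall Lmu : set R, countable Lmu ->
     is_riesz_basis (@exp1 R) mu Lmu ->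
     exists tau : R, tau != 0 /\
       is_riesz_basis (@exp2 R) (additive_measure mu)
         [set p + q | p in [set (l, l) | l in Lmu]
                    & q in [set (0, 0); (0, tau)]]) /\
  (riesz_spectral (@exp1 R) mu ->
   riesz_spectral (@exp2 R) (additive_measure mu)).
Proof.
have [tau tau0 [c c0 sep]] := separating_frequency mu_compact mu_supp0.
have sep_ae : \forall x \ae mu, c <= sqmod (exp1 tau x - 1)%R.
  by apply: filterS (ae_msupport mu) => x; exact: sep.
have basis L : is_riesz_basis (@exp1 R) mu L ->
    is_riesz_basis (@exp2 R) (additive_measure mu) (diag 0 @` L `|` diag tau @` L).
  move=> [frame bounds]; split.
  - exact: frame_additive sep_ae frame.
  - exact: riesz_additive sep_ae bounds.
split=> [L _ bL|[L [cL bL]]].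
  by exists tau; split=> //; rewrite diag_sumset; exact: basis.
exists (diag 0 @` L `|` diag tau @` L); split; last exact: basis.
rewrite -bigcup2E; apply: bigcup_countable => [|[|[|n]] _] //=.
- exact: card_le_trans (card_image_le _ _) cL.
- exact: card_le_trans (card_image_le _ _) cL.
Qed.
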